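(* Let $\Omega(t)\subset\mathbb{R}^N$ be a $T$-periodic domain and let $\mu$ be the principal periodic eigenvalue of $\Omega(t)$. Suppose there is a domain $\Omega_1$ such that $\Omega_1\subset\Omega(t)$ for all $t$, and let $\lambda(\Omega_1)$ be the principal eigenvalue of $-\nabla^2$ on $\Omega_1$ with zero Dirichlet boundary conditions. Then $$\mu\le D\,\lambda(\Omega_1).$$
   Context: $D>0$ and $T>0$ are constants. A $T$-periodic domain means a family of bounded, connected open sets $\Omega(t)\subset\mathbb{R}^N$, $t\in\mathbb{R}$, with $\Omega(t+T)=\Omega(t)$, subject to the following standing assumption. There are a bounded connected reference domain $\Omega_0\subset\mathbb{R}^N$ with boundary of class at least $C^{2+\varepsilon}$ for some $\varepsilon>0$, and one-to-one maps $h(\cdot,t):\overline{\Omega(t)}\to\overline{\Omega_0}$, $T$-periodic in $t$, transforming $\Omega(t)$ into $\Omega_0$, such that the change of variables $\xi=h(x,t)$, $u(\xi,t)=\psi(x,t)$ transforms the problem $\partial_t\psi=D\nabla^2\psi+f(\psi)$ in $\Omega(t)$, $\psi=0$ on $\partial\Omega(t)$, into $\partial_t u=\mathcal{L}(\xi,t)u+f(u)$ in $\Omega_0$, $u=0$ on $\partial\Omega_0$, where $$\mathcal{L}(\xi,t)u=\sum_{i,j}a_{ij}(\xi,t)\frac{\partial^2u}{\partial\xi_i\partial\xi_j}+\sum_j\big(b_j(\xi,t)+c_j(\xi,t)\big)\frac{\partial u}{\partial\xi_j},$$ $$a_{ij}=\sum_k D\frac{\partial h_i}{\partial x_k}\frac{\partial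 h_j}{\partial x_k},\qquad b_j=-\frac{\partial h_j}{\partial t},\qquad c_j=D\nabla^2h_j$$ (the right-hand sides being evaluated at the point $x$ with $h(x,t)=\xi$). It is assumed that $a_{ij},b_j,c_j\in C^{\alpha,\alpha/2}(\overline{\Omega_0}\times[0,T])$ for some $\alpha>0$ and that $(a_{ij})$ is uniformly elliptic. The principal periodic eigenvalue of $\Omega(t)$ is the unique real number $\mu$ for which there is a function $\phi(\xi,t)$ (unique up to scaling) satisfying $\partial_t\phi-\mathcal{L}\phi=\mu\phi$ for $\xi\in\Omega_0$, $t\in\mathbb{R}$; $\phi=0$ for $\xi\in\partial\Omega_0$; $\phi>0$ for $\xi\in\Omega_0$; and $\phi(\xi,t)\equiv\phi(\xi,t+T)$. (Existence and uniqueness are known, by Castro and Lazer.) *)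

(* Defs.v *)
From HB Require Import structures.
From mathcomp Require Import all_boot all_order all_algebra.
From mathcomp Require Import all_classical all_reals all_analysis.
Import Order.TTheory GRing.Theory Num.Theory.
Import numFieldNormedType.Exports.

Set Implicit Arguments.
Unset Strict Implicit.
Unset Printing Implicit Defensive.

Local Open Scope classical_set_scope.
Local Open Scope ring_scope.

(* The sigma-algebra generated by the coordinates, i.e. the Borel sets of R^n. *)
Section measurable_rV.
Variables (R : realType) (n : nat).

Let coord (i : 'I_n) (v : 'rV[R]_n) : measurableTypeR R := v ord0 i.

Let rV_set0 : g_sigma_preimage coord set0.
Proof. exact: sigma_algebra0. Qed.

Let rV_setC A : g_sigma_preimage coord A -> g_sigma_preimage coord (~` A).
Proof. exact: sigma_algebraC. Qed.

Let rV_bigcup (F : (set 'rV[R]_n)^nat) :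
  (forall i, g_sigma_preimage coord (F i)) ->
  g_sigma_preimage coord (\bigcup_i (F i)).
Proof. exact: sigma_algebra_bigcup. Qed.

HB.instance Definition _ := @isMeasurable.Build default_measure_display
  'rV[R]_n (g_sigma_preimage coord) rV_set0 rV_setC rV_bigcup.

Lemma measurable_rV_coord i :
  measurable_fun setT (fun v : 'rV[R]_n => v ord0 i : measurableTypeR R).
Proof.
move=> _ Y mY; rewrite setTI; apply: sub_sigma_algebra => /=.
rewrite -bigcup_seq/=; exists i => /=; first by rewrite mem_index_enum.
by exists Y => //; rewrite setTI.
Qed.

Lemma measurable_fun_rVP d (T : measurableType d) (f : T -> 'rV[R]_n) :
  (forall i, measurable_fun setT (fun x => f x ord0 i : measurableTypeR R)) ->
  measurable_fun setT f.
Proof.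
move=> mf _ B; rewrite setTI => mB.
have := mB; rewrite /measurable/= /g_sigma_preimage.
move=> /(_ [set C | measurable (f @^-1` C)]).
apply; split.
  split => /=.
  - by rewrite preimage_set0.
  - by move=> A mA; rewrite setTD -preimage_setC; exact: measurableC.
  - by move=> F mF; rewrite preimage_bigcup; exact: bigcup_measurable.
rewrite -bigcup_seq/= => C [i _ [Y mY]]; rewrite setTI => <- /=.
by have := mf i measurableT _ mY; rewrite setTI.
Qed.

End measurable_rV.

Section lebesgue_rV.
Variable R : realType.

Definition rV_cons n (p : measurableTypeR R * 'rV[R]_n) : 'rV[R]_n.+1 :=
  \row_i oapp (fun j => p.2 ord0 j) p.1 (unlift ord0 i).

Lemma measurable_rV_cons n : measurable_fun setT (@rV_cons n).
Proof.
apply: measurable_fun_rVP => i; under eq_fun do rewrite mxE.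
case: (unliftP ord0 i) => [j _|_] /=; last exact: measurable_fst.
exact: (measurableT_comp (@measurable_rV_coord R n j) measurable_snd).
Qed.

Section lebesgue_step.
Variables (n : nat) (m : {sigma_finite_measure set 'rV[R]_n -> \bar R}).
Local Open Scope ereal_scope.

Definition prod_lebesgue : set 'rV[R]_n.+1 -> \bar R :=
  pushforward (@lebesgue_measure R \x m) (@rV_cons n).

Let step0 : prod_lebesgue set0 = 0.
Proof. by rewrite /prod_lebesgue /pushforward preimage_set0 measure0. Qed.

Let step_ge0 A : 0 <= prod_lebesgue A.
Proof.
exact: (measure_ge0 (@lebesgue_measure R \x m)).
Qed.

Let mpre (A : set 'rV[R]_n.+1) : measurable A -> measurable (@rV_cons n @^-1` A).
Proof. by move=> mA; rewrite -[X in measurable X]setTI; exact: measurable_rV_cons. Qed.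

Let step_additive : semi_sigma_additive prod_lebesgue.
Proof.
move=> F mF tF mUF; rewrite /prod_lebesgue /pushforward preimage_bigcup.
apply: measure_semi_sigma_additive.
- by move=> k; exact: mpre.
- apply/trivIsetP => i j _ _ ij; rewrite -preimage_setI.
  by move/trivIsetP : tF => /(_ _ _ _ _ ij) ->//; rewrite preimage_set0.
- by rewrite -preimage_bigcup; exact: mpre.
Qed.

HB.instance Definition _ := isMeasure.Build _ _ _ prod_lebesgue
  step0 step_ge0 step_additive.

Let step_sigma_finite : sigma_finite setT prod_lebesgue.
Proof.
have /sigma_finiteP[F [FT ndF Foo]] := sigma_finiteT (@lebesgue_measure R).
have /sigma_finiteP[G [GT ndG Goo]] := sigma_finiteT m.
pose tl (v : 'rV[R]_n.+1) : measurableTypeR R * 'rV[R]_n :=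
  (v ord0 ord0, \row_j v ord0 (lift ord0 j)).
have consK : cancel (@rV_cons n) tl.
  move=> [x v]; rewrite /tl /rV_cons mxE unlift_none/=; congr pair.
  by apply/rowP => j; rewrite !mxE liftK.
have mtl : measurable_fun setT tl.
  apply/measurable_fun_pairP; split => /=; first exact: measurable_rV_coord.
  apply: measurable_fun_rVP => i /=.
  rewrite (_ : (fun _ => _) = fun v : 'rV[R]_n.+1 => v ord0 (lift ord0 i)).
    exact: measurable_rV_coord.
  by apply/funext => v; rewrite mxE.
exists (fun k => tl @^-1` (F k `*` G k)).
  rewrite -preimage_bigcup; apply/esym; rewrite -subTset => v _ /=.
  have [i _ Fi] : (\bigcup_i F i) (tl v).1 by rewrite -FT.
  have [j _ Gj] : (\bigcup_i G i) (tl v).2 by rewrite -GT.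
  exists (maxn i j) => //; split.
    by move: Fi; exact/subsetPset/ndF/leq_maxl.
  by move: Gj; exact/subsetPset/ndG/leq_maxr.
move=> k; have [mF Fk] := Foo k; have [mG Gk] := Goo k; split.
  by rewrite -[X in measurable X]setTI; apply: mtl => //; exact: measurableX.
rewrite /prod_lebesgue /pushforward (_ : _ @^-1` _ = F k `*` G k); last first.
  by rewrite -comp_preimage (_ : tl \o _ = id) //; apply/funext.
by rewrite product_measure1E// lte_mul_pinfty// ge0_fin_numE.
Qed.

HB.instance Definition _ := Measure_isSigmaFinite.Build _ _ _ prod_lebesgue
  step_sigma_finite.

Definition lebesgue_step : {sigma_finite_measure set 'rV[R]_n.+1 -> \bar R} :=
  prod_lebesgue.

End lebesgue_step.

(* Lebesgue measure on R^n as the n-fold product of the one on R. *)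
Fixpoint lebesgue_rV n : {sigma_finite_measure set 'rV[R]_n -> \bar R} :=
  match n with
  | 0 => \d_(0 : 'rV[R]_0)
  | n'.+1 => lebesgue_step (lebesgue_rV n')
  end.

Lemma lebesgue_rV_box n (A : 'I_n -> set (measurableTypeR R)) :
  (forall i, measurable (A i)) ->
  lebesgue_rV n [set v | forall i, A i (v ord0 i)] =
  (\prod_(i < n) lebesgue_measure (A i))%E.
Proof.
elim: n A => [|n IH] A mA.
  rewrite big_ord0 /= diracE; case: (boolP (_ \in _)) => //.
  by rewrite notin_setE => -[] [].
rewrite big_ord_recl -(IH (fun j => A (lift ord0 j)))// /= -product_measure1E//.
  rewrite /pushforward; congr product_measure1; apply/seteqP; split => -[x v] /=; rewrite /rV_cons.
    move=> Av; split => [|j]; first by have := Av ord0; rewrite mxE unlift_none.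
    by have := Av (lift ord0 j); rewrite mxE liftK.
  by move=> [Ax Av] i; rewrite mxE; case: unliftP => [j ->|->].
pose B i : set 'rV[R]_n :=
  (fun v => v ord0 i : measurableTypeR R) @^-1` A (lift ord0 i).
rewrite [X in measurable X](_ : _ = \bigcap_(i : 'I_n) B i).
  apply: fin_bigcap_measurable => // i _; rewrite -[X in measurable X]setTI.
  exact: measurable_rV_coord.
by apply/seteqP; split => v Bv i; [move=> _|]; exact: Bv.
Qed.

End lebesgue_rV.

Section function_spaces.
Variables (R : realType) (N : nat).
Implicit Types (A : set 'rV[R]_N) (f : 'rV[R]_N -> R).

Definition domain A := [/\ open A, connected A & A !=set0].

Definition frontier A := closure A `\` interior A.

Definition pd (i : 'I_N) f : 'rV[R]_N -> R := 'D_(delta_mx ord0 i) f.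

Definition laplacian f (x : 'rV[R]_N) : R := \sum_(k < N) pd k (pd k f) x.

Fixpoint Ck (k : nat) A f : Prop :=
  (forall x, A x -> {for x, continuous f}) /\
  if k is k'.+1 then
    forall i, (forall x, A x -> derivable f x (delta_mx ord0 i)) /\
              Ck k' A (pd i f)
  else True.

(* Hoelder norms are taken with the sup norm of 'rV[R]_N, which is equivalent
   to the Euclidean one. *)
Definition holder (e : R) A f :=
  exists C : R, forall x y, A x -> A y -> `|f x - f y| <= C * `|x - y| `^ e.

Definition C2_holder (e : R) A f :=
  Ck 2 A f /\ forall i j, holder e A (pd i (pd j f)).

(* Near each boundary point A is straightened onto a half-space by a
   C^{2+e}-diffeomorphism chi with inverse chi'. *)
Definition C2_holder_boundary (e : R) A :=
  forall p, frontier A p ->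
  exists (U V : set 'rV[R]_N) (chi chi' : 'rV[R]_N -> 'rV[R]_N) (k : 'I_N),
    [/\ [/\ open U, open V & U p],
        [/\ chi @` U = V, {in U, cancel chi chi'} & {in V, cancel chi' chi}],
        forall i, C2_holder e U (fun x => chi x ord0 i),
        forall i, C2_holder e V (fun x => chi' x ord0 i)
      & forall x, U x -> (A x <-> 0 < chi x ord0 k)].

Definition test_function A f :=
  (forall k, Ck k setT f) /\
  exists K, [/\ compact K, K `<=` A & forall x, ~ K x -> f x = 0].

(* Membership in H^1_0(A) for f of class C^1 on the open set A: f is the limit
   in the H^1(A) norm of functions in C_c^oo(A). *)
Definition in_H10 A f :=
  exists2 eta : nat -> 'rV[R]_N -> R, (forall m, test_function A (eta m)) &
    (\int[lebesgue_rV R N]_(x in A)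
       ((eta m x - f x) ^+ 2 +
        \sum_(i < N) (pd i (eta m) x - pd i f x) ^+ 2)%:E)%E @[m --> \oo]
    --> 0%E.

(* No regularity of the boundary of A is assumed, so the Dirichlet condition is
   read in H^1_0(A).  The eigenfunction is positive, which singles out the
   principal eigenvalue; it is smooth in A by interior regularity. *)
Definition principal_dirichlet_eigenvalue A (lam : R) :=
  exists phi : 'rV[R]_N -> R,
    [/\ Ck 2 A phi,
        forall x, A x -> - laplacian phi x = lam * phi x,
        in_H10 A phi
      & forall x, A x -> 0 < phi x].

End function_spaces.

Section periodic_domains.
Variables (R : realType) (N : nat).
Implicit Types (Omega : R -> set 'rV[R]_N) (u : 'rV[R]_N -> R -> R).

Definition spacetime Omega : set ('rV[R]_N * R) := [set p | Omega p.2 p.1].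

Definition pdt u (x : 'rV[R]_N) (t : R) : R := derive1 (u x) t.

Definition continuous_on (Q : set ('rV[R]_N * R)) u :=
  forall p, Q p -> {for p, continuous (fun q : 'rV[R]_N * R => u q.1 q.2)}.

Definition C21 (Q : set ('rV[R]_N * R)) u :=
  [/\ continuous_on Q u,
      (forall x t, Q (x, t) -> derivable (u x) t 1) /\ continuous_on Q (pdt u),
      forall i,
        (forall x t, Q (x, t) -> derivable (u^~ t) x (delta_mx ord0 i)) /\
        continuous_on Q (fun x t => pd i (u^~ t) x)
    & forall i j,
        (forall x t, Q (x, t) ->
           derivable (pd j (u^~ t)) x (delta_mx ord0 i)) /\
        continuous_on Q (fun x t => pd i (pd j (u^~ t)) x)].

Definition classical_dirichlet Omega u :=
  [/\ C21 (spacetime Omega) u,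
      {within spacetime (fun t => closure (Omega t)),
        continuous (fun q : 'rV[R]_N * R => u q.1 q.2)}
    & forall t x, frontier (Omega t) x -> u x t = 0].

Definition parabolic_holder (alpha T : R) (A : set 'rV[R]_N) u :=
  exists C : R, forall x y s t, A x -> A y -> 0 <= s <= T -> 0 <= t <= T ->
    `|u x s - u y t| <= C * (`|x - y| `^ alpha + `|s - t| `^ (alpha / 2)).

Definition calL (a : 'I_N -> 'I_N -> 'rV[R]_N -> R -> R)
    (b c : 'I_N -> 'rV[R]_N -> R -> R) u (xi : 'rV[R]_N) (t : R) : R :=
  \sum_(i < N) \sum_(j < N) a i j xi t * pd i (pd j (u^~ t)) xi +
  \sum_(j < N) (b j xi t + c j xi t) * pd j (u^~ t) xi.

Definition solves_moving (D : R) (f : R -> R) Omega (psi : 'rV[R]_N -> R -> R) :=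
  classical_dirichlet Omega psi /\
  forall t x, Omega t x ->
    pdt psi x t = D * laplacian (psi^~ t) x + f (psi x t).

Definition solves_fixed a b c (f : R -> R) (Omega0 : set 'rV[R]_N) u :=
  classical_dirichlet (fun=> Omega0) u /\
  forall t xi, Omega0 xi -> pdt u xi t = calL a b c u xi t + f (u xi t).

(* h and the coefficients are total functions; only h on the closure of
   Omega(t) and the coefficients on the closure of Omega0 matter.  The
   coefficients are prescribed in the open set Omega0, and Hoelder continuity
   determines them on its boundary. *)
Record periodic_domain (D T : R) Omega (Omega0 : set 'rV[R]_N)
    (h : 'rV[R]_N -> R -> 'rV[R]_N)
    (a : 'I_N -> 'I_N -> 'rV[R]_N -> R -> R)
    (b c : 'I_N -> 'rV[R]_N -> R -> R) : Prop := PeriodicDomain {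
  pd_domain : forall t, domain (Omega t) /\ bounded_set (Omega t) ;
  pd_periodic : forall t, Omega (t + T) = Omega t ;
  (* needed for the time derivatives at points of Omega(t) to make sense *)
  pd_spacetime_open : open (spacetime Omega) ;
  pd_ref_domain : domain Omega0 /\ bounded_set Omega0 ;
  pd_ref_boundary : exists2 e : R, 0 < e < 1 & C2_holder_boundary e Omega0 ;
  pd_h_bij : forall t,
    set_bij (closure (Omega t)) (closure Omega0) (h^~ t) ;
  pd_h_image : forall t, h^~ t @` Omega t = Omega0 ;
  pd_h_periodic : forall t x, closure (Omega t) x -> h x (t + T) = h x t ;
  pd_h_continuous : {within spacetime (fun t => closure (Omega t)),
    continuous (fun q : 'rV[R]_N * R => h q.1 q.2)} ;
  pd_h_C21 : forall i, C21 (spacetime Omega) (fun x t => h x t ord0 i) ;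
  pd_a : forall t x, Omega t x -> forall i j, a i j (h x t) t =
    \sum_(k < N) D * pd k (fun y => h y t ord0 i) x
                   * pd k (fun y => h y t ord0 j) x ;
  pd_b : forall t x, Omega t x -> forall j,
    b j (h x t) t = - pdt (fun y s => h y s ord0 j) x t ;
  pd_c : forall t x, Omega t x -> forall j,
    c j (h x t) t = D * laplacian (fun y => h y t ord0 j) x ;
  pd_transforms : forall (f : R -> R) (psi u : 'rV[R]_N -> R -> R),
    (forall t x, closure (Omega t) x -> psi x t = u (h x t) t) ->
    solves_moving D f Omega psi <-> solves_fixed a b c f Omega0 u ;
  pd_holder : exists2 alpha : R, 0 < alpha < 1 &
    [/\ forall i j, parabolic_holder alpha T (closure Omega0) (a i j),
        forall j, parabolic_holder alpha T (closure Omega0) (b j)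
      & forall j, parabolic_holder alpha T (closure Omega0) (c j)] ;
  pd_elliptic : exists2 theta : R, 0 < theta &
    forall xi t (v : 'rV[R]_N), closure Omega0 xi -> 0 <= t <= T ->
      theta * \sum_(i < N) v ord0 i ^+ 2 <=
      \sum_(i < N) \sum_(j < N) a i j xi t * v ord0 i * v ord0 j }.

Definition principal_periodic_eigenvalue (T : R) (Omega0 : set 'rV[R]_N) a b c
    (mu : R) :=
  exists phi : 'rV[R]_N -> R -> R,
    [/\ classical_dirichlet (fun=> Omega0) phi,
        forall xi t, Omega0 xi ->
          pdt phi xi t - calL a b c phi xi t = mu * phi xi t,
        forall xi t, Omega0 xi -> 0 < phi xi t
      & forall xi t, closure Omega0 xi -> phi xi t = phi xi (t + T)].

End periodic_domains.

(* Main.v *)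
Require Import Defs.
From HB Require Import structures.
From mathcomp Require Import all_boot all_order all_algebra.
From mathcomp Require Import all_classical all_reals all_analysis.
From mathcomp Require Import measurable_realfun ring lra.
Import Order.TTheory GRing.Theory Num.Theory.
Import numFieldNormedType.Exports.
Local Open Scope classical_set_scope.
Local Open Scope ring_scope.

(** Write psi(x, t) = phi(h(x, t), t) for the periodic eigenfunction pulled back
    to the moving domain.  The standing assumption on the change of variables,
    used with the reaction term v |-> mu v, says that psi > 0 solves
    psi_t = D Lap psi + mu psi in Omega(t), hence in Omega1 at all times; and psi
    is T-periodic in t.

    Fix a test function eta of Omega1.  Picone's inequality, that is the
    divergence theorem for the field eta^2 grad psi / psi together with the
    positivity of |grad eta - eta grad psi / psi|^2, gives at each time t
      0 <= int |grad eta|^2 + int eta^2 (Lap psi / psi)(., t)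
    ([picone]).  Since D Lap psi / psi = d/dt (ln psi) - mu, averaging over a
    period removes the time derivative and leaves
      mu int eta^2 <= D int |grad eta|^2
    ([periodic_energy]).  The average is taken over equally spaced sample times:
    by the mean value theorem and the periodicity of ln psi, the sampled
    derivatives of ln psi average to a quantity that uniform continuity makes
    small, uniformly on the support of eta ([riemann_log_derivative]).  Only
    integrals over space occur, and nothing is differentiated under an integral
    sign.

    So kappa = mu / D is a lower bound of the Rayleigh quotient on test functions.
    It remains to see that such a bound is at most lambda1
    ([dirichlet_rayleigh]).  Testing the equation of the eigenfunction w of Omega1
    with eta (again by the divergence theorem, [weak_eigen]) gives
      int grad eta . grad w = lambda1 int eta w.
    Along test functions eta converging to w in H^1, this makes the quotient of
    eta tend to lambda1, and int w^2 > 0 because w > 0.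

    The divergence theorem is that of a compactly supported field; it reduces by
    Fubini to the fundamental theorem of calculus on lines
    ([integral_pd_eq0]). *)

Set Implicit Arguments.
Unset Strict Implicit.
Unset Printing Implicit Defensive.

(** * Lebesgue measure on row vectors: Borel sets and integrability *)

Section measure.
Variable R : realType.

Lemma measurable_rV_cube n (A : 'I_n -> set (measurableTypeR R)) :
  (forall i, measurable (A i)) ->
  measurable [set v : 'rV[R]_n | forall i, A i (v ord0 i)].
Proof.
move=> mA; pose B i : set 'rV[R]_n :=
  (fun v => v ord0 i : measurableTypeR R) @^-1` A i.
rewrite [X in measurable X](_ : _ = \bigcap_(i : 'I_n) B i).
  apply: fin_bigcap_measurable => // i _; rewrite -[X in measurable X]setTI.
  exact: measurable_rV_coord.
by apply/seteqP; split => v Bv i; [move=> _|]; exact: Bv.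
Qed.

(** The measurable sets are generated by the coordinates, so an open set has to be
    written as a countable union of cubes, with rational centres and radii 1/k. *)
Lemma open_measurable_rV n (A : set 'rV[R]_n) : open A -> measurable A.
Proof.
move=> oA.
pose B (p : {ffun 'I_n -> rat} * nat) : set 'rV[R]_n :=
  [set v | forall i, ball (ratr (p.1 i) : R) (p.2.+1%:R^-1) (v ord0 i)].
pose F p := if `[< B p `<=` A >] then B p else set0.
have -> : A = \bigcup_p F p.
  apply/seteqP; split => [x Ax|x [p _]]; last first.
    by rewrite /F; case: asboolP => // + Bx; exact.
  have /nbhs_ballP[e /= e0 xeA] : nbhs x A by exact: open_nbhs_nbhs.
  have [k ke] : exists k : nat, k.+1%:R^-1 < e / 2.
    have e2 : 0 < e / 2 by rewrite divr_gt0.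
    have [k _ kP] := near_infty_natSinv_lt (PosNum e2).
    by exists k; apply: kP => /=.
  have /choice[q qP] : forall i, exists q : rat, `|ratr q - x ord0 i| < k.+1%:R^-1.
    move=> i; have k0 : 0 < k.+1%:R^-1 :> R by rewrite invr_gt0.
    have [|q] := @rat_in_itvoo _ (x ord0 i - k.+1%:R^-1) (x ord0 i + k.+1%:R^-1).
      by rewrite ltrD2l gtrN.
    rewrite in_itv/= => qx; exists q.
    by rewrite ltr_distlC -ltr_distl distrC ltr_distl.
  exists (finfun q, k) => //; rewrite /F; case: asboolP => [_ i|[]].
    by rewrite /ball/= ffunE.
  move=> y By; apply: xeA; split => // i j; rewrite ord1.
  have := By j; have := qP j; rewrite /ball/= ffunE => h1 h2.
  rewrite (le_lt_trans (ler_distD (ratr (q j)) _ _))// (splitr e) ltrD//.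
    by rewrite distrC (lt_trans h1).
  by rewrite (lt_trans h2).
apply: countable_bigcupT_measurable; first exact: countableP.
move=> p; rewrite /F; case: asboolP => // _.
apply: (@measurable_rV_cube _
  (fun i => ball (ratr (p.1 i) : R) (p.2.+1%:R^-1))) => i.
by apply: open_measurable; apply: ball_open; rewrite invr_gt0.
Qed.

Lemma open_measurable_fun_rV n (A : set 'rV[R]_n) (f : 'rV[R]_n -> R) :
  open A -> (forall x, A x -> {for x, continuous f}) -> measurable_fun A f.
Proof.
move=> oA cf mA; apply: (measurability _ (RGenOpens.measurableE R)) => //.
move=> _ [_ [a [b ->] <-]]; apply: open_measurable_rV.
rewrite openE => x [Ax fx]; apply: filterI; first exact: open_nbhs_nbhs.
by apply: (cf x Ax); apply: open_nbhs_nbhs; split => //; exact: interval_open.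
Qed.

(** Bounding the coordinates, rather than asking for a compact support, makes the
    notion stable under restriction to the slices of Fubini's theorem. *)
Definition bounded_support n (f : 'rV[R]_n -> R) :=
  exists M : R, forall (v : 'rV[R]_n) i, M < `|v ord0 i| -> f v = 0.

Lemma integrable_continuous_rV n (f : 'rV[R]_n -> R) :
  continuous f -> bounded_support f ->
  (lebesgue_rV R n).-integrable setT (EFin \o f).
Proof.
move=> cf [M fM]; pose I : 'I_n -> set (measurableTypeR R) := fun=> `[-M, M]%classic.
pose K := [set v : 'rV[R]_n | forall i, I i (v ord0 i)].
have mK : measurable K.
  by apply: (measurable_rV_cube (A := I)) => i; exact: measurable_itv.
have cK : compact K by apply: (rV_compact (A := I)) => i; exact: segment_compact.
have mf : measurable_fun setT f.
  by apply: open_measurable_fun_rV => [|x _]; [exact: openT|exact: cf].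
have Kfin : (lebesgue_rV R n K < +oo)%E.
  rewrite (lebesgue_rV_box (A := I)); last by move=> i; exact: measurable_itv.
  rewrite -ge0_fin_numE; last by apply: prode_ge0.
  by apply: (big_ind (fun x => x \is a fin_num)) => // [x y|i _];
   [exact: fin_numM|rewrite /I lebesgue_measure_itv; case: ifP].
have <- : (EFin \o f) \_ K = EFin \o f.
  apply/funext => v; rewrite patchE; case: ifPn => //; rewrite notin_setE => nK.
  have [i iM] : exists i, ~ I i (v ord0 i) by apply/existsNP.
  rewrite /= (fM v i)// ltNge; apply/negP => h; apply: iM.
  by rewrite /I/= in_itv/= -ler_norml.
apply/(integrable_mkcond _ mK); apply: measurable_bounded_integrable => //.
- exact: measurable_funTS.
- have := compact_bounded (continuous_compact (continuous_subspaceT cf) cK).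
  move=> [r [rr rP]]; exists r; split => // x rx v /= Kv.
  by apply: rP => //; exists v.
Qed.

Lemma integral_derive_eq0 (f g : R -> R) (M : R) :
  continuous g -> (forall x : R, is_derive x (1 : R) f (g x)) ->
  (forall x : R, M < `|x| -> f x = 0) -> (forall x : R, M < `|x| -> g x = 0) ->
  (\int[@lebesgue_measure R]_x (g x)%:E = 0)%E.
Proof.
move=> cg fg fM gM; pose a := `|M| + 1.
have a0 : 0 < a by rewrite ltr_wpDl.
have Ma : M < a by rewrite (le_lt_trans (ler_norm _))// ltrDl.
have cf : continuous f.
  move=> x; apply: differentiable_continuous; apply/derivable1_diffP.
  exact: (@ex_derive _ _ _ _ _ _ _ (fg x)).
have -> : (fun x => (g x)%:E) = (fun x => (g x)%:E) \_ `[- a, a].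
  apply/funext => x; rewrite patchE; case: ifPn => //.
  rewrite notin_setE/= in_itv/= -ler_norml => /negP.
  by rewrite -ltNge => ax; rewrite gM// (lt_trans Ma).
rewrite -integral_mkcond (@continuous_FTC2 _ _ f).
- by rewrite !fM ?subee ?normrN ?gtr0_norm.
- by rewrite gtrN.
- exact: continuous_subspaceT.
- split => [x _||]; first exact: (@ex_derive _ _ _ _ _ _ _ (fg x)).
  + exact/cvg_at_right_filter/cf.
  + exact/cvg_at_left_filter/cf.
- by move=> x _; rewrite derive1E; exact: (@derive_val _ _ _ _ _ _ _ (fg x)).
Qed.

End measure.

(** * Integration along coordinates *)

Section ibp.
Variable R : realType.

(** Directional derivatives restrict to lines and slices: [L] need only send the
    line through [x] along [u] to the line through [L x] along [u']. *)
Lemma is_derive_comp_affine (U V : normedModType R) (L : U -> V) (u x : U) (u' : V)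
    (F : V -> R) (d : R) :
  (forall h : R, L (h *: u + x) = h *: u' + L x) ->
  is_derive (L x) u' F d -> is_derive x u (F \o L) d.
Proof.
move=> Lu [dF dv].
have E : (fun h : R => h^-1 *: ((F \o L) (h *: u + x) - (F \o L) x)) =
         (fun h : R => h^-1 *: (F (h *: u' + L x) - F (L x))).
  by apply/funext => h /=; rewrite Lu.
split; first by move: dF; rewrite /derivable/= -E.
by rewrite -dv /derive -E.
Qed.

Lemma rV_cons_continuous_l n (v : 'rV[R]_n) :
  continuous (fun s : R => rV_cons (s, v)).
Proof.
move=> s; apply/cvg_ballP => e e0; apply/nbhs_ballP; exists e => //= t st.
split => // i j; rewrite !mxE; case: unliftP => [k _|_] /=; first exact: ballxx.
exact: st.
Qed.

Lemma rV_cons_continuous_r n (s : R) :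
  continuous (fun v : 'rV[R]_n => rV_cons (s, v)).
Proof.
move=> v A /nbhs_ballP[e /= e0 eA].
apply/nbhs_ballP; exists e => //= w [_ vw]; apply: eA.
split => // i j; rewrite !mxE; case: unliftP => [k _|_] /=; last exact: ballxx.
exact: (vw ord0 k).
Qed.

(** Both orders of integration are given: a derivative integrates to zero only
    along its own coordinate, which may be the head or belong to the tail. *)
Lemma integral_lebesgue_rV_cons n (G : 'rV[R]_n.+1 -> R) :
  continuous G -> bounded_support G ->
  (\int[lebesgue_rV R n.+1]_x (G x)%:E =
     \int[@lebesgue_measure R]_s \int[lebesgue_rV R n]_v (G (rV_cons (s, v)))%:E /\
   \int[lebesgue_rV R n.+1]_x (G x)%:E =
     \int[lebesgue_rV R n]_v \int[@lebesgue_measure R]_s (G (rV_cons (s, v)))%:E)%E.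
Proof.
move=> cG bG; have iG := integrable_continuous_rV cG bG.
have mG : measurable_fun setT G.
  by apply: open_measurable_fun_rV => [|x _]; [exact: openT|exact: cG].
pose P := (@lebesgue_measure R \x lebesgue_rV R n)%E.
have mGc : measurable_fun setT (fun p : measurableTypeR R * 'rV[R]_n => (G (rV_cons p))%:E).
  by apply/measurable_EFinP; apply: measurableT_comp => //; exact: measurable_rV_cons.
have iGc : P.-integrable setT (fun p => (G (rV_cons p))%:E).
  apply/integrableP; split => //.
  case/integrableP : iG => _; apply: le_lt_trans.
  rewrite [leRHS](_ : _ = \int[P]_(x in (@rV_cons R n) @^-1` setT)
    ((abse \o (EFin \o G)) \o (@rV_cons R n)) x)%E//.
  rewrite -ge0_integral_pushforward//; first exact: measurable_rV_cons.
    by apply: measurableT_comp => //; exact/measurable_EFinP.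
  by move=> x _; exact: abse_ge0.
have E0 : (\int[lebesgue_rV R n.+1]_x (G x)%:E = \int[P]_p (G (rV_cons p))%:E)%E.
  transitivity (\int[pushforward P (@rV_cons R n)]_x (EFin \o G) x)%E => //.
  rewrite integral_pushforward//; first exact: measurable_rV_cons.
    by apply/measurable_EFinP.
by split; apply: (etrans E0);
  [rewrite -integral12_prod_meas1|rewrite -integral21_prod_meas1].
Qed.

(** Integrating first along the direction of differentiation, the integral over
    each line is a difference of values of [F] outside its support.  The induction
    brings the coordinate to the head of the vector, one coordinate at a time. *)
Lemma integral_pd_eq0 n (i : 'I_n) (F G : 'rV[R]_n -> R) :
  continuous G -> (forall x, is_derive x (delta_mx ord0 i : 'rV[R]_n) F (G x)) ->
  bounded_support F -> bounded_support G ->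
  (\int[lebesgue_rV R n]_x (G x)%:E = 0)%E.
Proof.
elim: n i F G => [[]//|n IH] i F G cG FG bF bG.
have [E1 E2] := integral_lebesgue_rV_cons cG bG.
have [MF MFP] := bF; have [MG MGP] := bG.
have [j ij|i0] := unliftP ord0 i.
  rewrite E1; apply: integral0_eq => s _.
  apply: (IH j (fun v => F (rV_cons (s, v)))).
  - move=> v; apply: continuous_comp; [exact: rV_cons_continuous_r|exact: cG].
  - move=> v; apply: (is_derive_comp_affine (L := fun v => rV_cons (s, v))) (FG _) => h.
    rewrite ij; apply/rowP => k; rewrite !mxE;
    case: unliftP => [l ->|->] /=; rewrite ?mxE /=.
      by rewrite (inj_eq lift_inj).
    by rewrite mulr0 add0r.
  - by exists MF => v k vM; apply: (MFP _ (lift ord0 k)); rewrite mxE liftK.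
  - by exists MG => v k vM; apply: (MGP _ (lift ord0 k)); rewrite mxE liftK.
rewrite E2; apply: integral0_eq => v _.
apply: (@integral_derive_eq0 _ (fun s => F (rV_cons (s, v))) _ (Num.max MF MG)).
- move=> s; apply: continuous_comp; [exact: rV_cons_continuous_l|exact: cG].
- move=> s; apply: (is_derive_comp_affine (L := fun s : R => rV_cons (s, v))) (FG _) => h.
  rewrite i0; apply/rowP => k; rewrite !mxE; case: unliftP => [l ->|->] /=.
    by rewrite mulr0 add0r.
  by rewrite [h%:A]mulr1 mulr1.
- by move=> s; rewrite gt_max => /andP[sM _]; apply: (MFP _ ord0); rewrite mxE unlift_none.
- by move=> s; rewrite gt_max => /andP[_ sM]; apply: (MGP _ ord0); rewrite mxE unlift_none.
Qed.

End ibp.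

(** * Functions with compact support *)

Section glue.
Variables (R : realType) (n : nat).
Implicit Types (A K : set 'rV[R]_n) (f g : 'rV[R]_n -> R).

(** A product that vanishes off [K] is zero there even when one factor (a quotient
    by [g], a derivative of [w]) is only meaningful on an open set around [K]; no
    extension by zero has to be introduced. *)
Definition supported K f := forall x, ~ K x -> f x = 0.

Lemma near_supported_eq0 K f x : compact K -> supported K f -> ~ K x ->
  \near x, f x = 0.
Proof.
move=> cK fK nKx.
have cKl : closed K by apply: compact_closed => //; exact: norm_hausdorff.
have : nbhs x (~` K) by apply: open_nbhs_nbhs; split => //; exact: closed_openC.
by apply: filterS => y; exact: fK.
Qed.

Lemma supported_continuous A K f : compact K -> K `<=` A -> supported K f ->
  (forall x, A x -> {for x, continuous f}) -> continuous f.
Proof.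
move=> cK KA fK cf x; have [Kx|nKx] := pselect (K x); first exact/cf/KA.
have f0 := near_supported_eq0 cK fK nKx.
rewrite /continuous_at (fK _ nKx).
exact: (@cvg_near_cst _ R 0 f (nbhs x) (nbhs_filter x) f0).
Qed.

Lemma supported_is_derive A K f g v : compact K -> K `<=` A ->
  supported K f -> supported K g ->
  (forall x, A x -> is_derive x v f (g x)) -> forall x, is_derive x v f (g x).
Proof.
move=> cK KA fK gK dfg x; have [Kx|nKx] := pselect (K x); first exact/dfg/KA.
have f0 : \near x, 0 = f x by apply: filterS (near_supported_eq0 cK fK nKx) => y ->.
rewrite gK//; split.
  by apply: (near_eq_derivable f0); exact: derivable_cst.
by rewrite -(near_eq_derive _ f0) derive_cst.
Qed.

Lemma supported_pd K f i : compact K -> supported K f -> supported K (pd i f).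
Proof.
move=> cK fK x nKx; have := near_supported_eq0 cK fK nKx.
by move=> /(near_eq_derive (delta_mx ord0 i)); rewrite /pd => ->; exact: derive_cst.
Qed.

Lemma supported_bounded K f : compact K -> supported K f -> bounded_support f.
Proof.
move=> /compact_bounded[M [Mr MP]] fK; exists (M + 1) => v i vM.
apply: fK => Kv; have M1 : M < M + 1 by rewrite ltrDl.
have /= := MP _ M1 _ Kv; rewrite leNgt => /negP[].
apply: (lt_le_trans vM); rewrite [leRHS]/Num.norm /= mx_normrE.
by apply/bigmax_geP; right => /=; exists (ord0, i).
Qed.

End glue.

Section integral.
Variables (R : realType) (n : nat).
Implicit Types (f g : 'rV[R]_n -> R).

Definition Cc f := continuous f /\ bounded_support f.

Definition Int f : R := \int[lebesgue_rV R n]_x f x.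

Lemma Cc_integrable f : Cc f -> (lebesgue_rV R n).-integrable setT (EFin \o f).
Proof. by case; exact: integrable_continuous_rV. Qed.

Lemma CcD f g : Cc f -> Cc g -> Cc (fun x => f x + g x).
Proof.
move=> [cf [M fM]] [cg [N gN]]; split; first by move=> x; exact: (cvgD (cf x) (cg x)).
exists (Num.max M N) => v i; rewrite gt_max => /andP[Mv Nv].
by rewrite (fM v i)// (gN v i)// addr0.
Qed.

Lemma CcZ (k : R) f : Cc f -> Cc (fun x => k * f x).
Proof.
move=> [cf [M fM]]; split; first by move=> x; exact: (cvgM (cvg_cst k) (cf x)).
by exists M => v i Mv; rewrite (fM v i)// mulr0.
Qed.

Lemma Cc0 : Cc (fun=> 0).
Proof. split; last by exists 0.
by move=> x; apply: cvg_cst; exact: nbhs_filter. Qed.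

Lemma Cc_sum (I : Type) (r : seq I) (F : I -> 'rV[R]_n -> R) :
  (forall i, Cc (F i)) -> Cc (fun x => \sum_(i <- r) F i x).
Proof.
move=> cF; elim: r => [|i r IH].
  by under eq_fun do rewrite big_nil; exact: Cc0.
by under eq_fun do rewrite big_cons; exact: CcD.
Qed.

Lemma IntD f g : Cc f -> Cc g -> Int (fun x => f x + g x) = Int f + Int g.
Proof. by move=> /Cc_integrable cf /Cc_integrable cg; rewrite /Int RintegralD. Qed.

Lemma IntZ (k : R) f : Cc f -> Int (fun x => k * f x) = k * Int f.
Proof. by move=> /Cc_integrable cf; rewrite /Int RintegralZl. Qed.

Lemma Int_sum (I : Type) (r : seq I) (F : I -> 'rV[R]_n -> R) :
  (forall i, Cc (F i)) ->
  Int (fun x => \sum_(i <- r) F i x) = \sum_(i <- r) Int (F i).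
Proof.
move=> cF; elim: r => [|i r IH].
  rewrite big_nil /Int; under eq_Rintegral do rewrite big_nil.
  by rewrite Rintegral_cst// mul0r.
rewrite big_cons -IH -IntD//; last exact: Cc_sum.
by apply: eq_Rintegral => x _; rewrite big_cons.
Qed.

Lemma le_Int f g : Cc f -> Cc g -> (forall x, f x <= g x) -> Int f <= Int g.
Proof.
by move=> /Cc_integrable cf /Cc_integrable cg fg; apply: le_Rintegral => // x _; exact: fg.
Qed.

End integral.

(** * Divergence theorem for compactly supported fields *)

Section divergence.
Variables (R : realType) (n : nat).
Implicit Types (A K : set 'rV[R]_n).
Local Notation e_ i := (delta_mx ord0 i : 'rV[R]_n).

Lemma supported_Cc A K f : compact K -> K `<=` A -> supported K f ->
  (forall x, A x -> {for x, continuous f}) -> Cc f.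
Proof.
move=> cK KA fK cf; split; first exact: (supported_continuous cK KA fK cf).
exact: (supported_bounded cK fK).
Qed.

Lemma Int_divergence A K (F G : 'I_n -> 'rV[R]_n -> R) :
  compact K -> K `<=` A ->
  (forall i, supported K (F i)) -> (forall i, supported K (G i)) ->
  (forall i x, A x -> {for x, continuous (G i)}) ->
  (forall i x, A x -> is_derive x (e_ i) (F i) (G i x)) ->
  Int (fun x => \sum_(i < n) G i x) = 0.
Proof.
move=> cK KA FK GK cG FG.
have CG i : Cc (G i) by exact: (supported_Cc cK KA (GK i) (cG i)).
rewrite Int_sum// big1// => i _; rewrite /Int /Rintegral.
have FG' := supported_is_derive cK KA (FK i) (GK i) (FG i).
by rewrite (integral_pd_eq0 (proj1 (CG i)) FG'
  (supported_bounded cK (FK i)) (proj2 (CG i))).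
Qed.

Lemma Ck2P A (g : 'rV[R]_n -> R) : Ck 2 A g ->
  [/\ forall x, A x -> {for x, continuous g},
     forall i x, A x -> is_derive x (e_ i) g (pd i g x),
     forall i x, A x -> {for x, continuous (pd i g)},
     forall i x, A x -> is_derive x (e_ i) (pd i g) (pd i (pd i g) x)
   & forall i x, A x -> {for x, continuous (pd i (pd i g))}].
Proof.
move=> [cg /= dg]; split => // i x Ax; have [d1 [c1 /(_ i)[d2 [c2 _]]]] := dg i.
- by split; [exact: d1|].
- exact: c1.
- by split; [exact: d2|].
- exact: c2.
Qed.

End divergence.

(** * Pointwise calculus of real functions of a row vector *)

Section continuity.
Variables (R : realType) (n : nat).
Implicit Types (f g : 'rV[R]_n -> R) (x : 'rV[R]_n).

Lemma contD f g x : {for x, continuous f} -> {for x, continuous g} ->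
  {for x, continuous (fun y => f y + g y)}.
Proof. by move=> cf cg; exact: (@cvgD _ _ _ (nbhs x) (nbhs_filter x) _ _ _ _ cf cg). Qed.

Lemma contB f g x : {for x, continuous f} -> {for x, continuous g} ->
  {for x, continuous (fun y => f y - g y)}.
Proof. by move=> cf cg; exact: (@cvgB _ _ _ (nbhs x) (nbhs_filter x) _ _ _ _ cf cg). Qed.

Lemma contM f g x : {for x, continuous f} -> {for x, continuous g} ->
  {for x, continuous (fun y => f y * g y)}.
Proof. by move=> cf cg; exact: (@cvgM _ _ (nbhs x) (nbhs_filter x) _ _ _ _ cf cg). Qed.

Lemma contX2 f x : {for x, continuous f} -> {for x, continuous (fun y => f y ^+ 2)}.
Proof. by move=> cf; exact: contM. Qed.

Lemma contC (k : R) x : {for x, continuous (fun _ : 'rV[R]_n => k)}.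
Proof. by apply: cvg_cst; exact: nbhs_filter. Qed.

Lemma contV f x : f x != 0 -> {for x, continuous f} ->
  {for x, continuous (fun y => (f y)^-1)}.
Proof. by move=> f0 cf; exact: (@cvgV _ _ _ (nbhs_filter x) _ _ f0 cf). Qed.

Lemma cont_sum (I : Type) (r : seq I) (F : I -> 'rV[R]_n -> R) x :
  (forall i, {for x, continuous (F i)}) ->
  {for x, continuous (fun y => \sum_(i <- r) F i y)}.
Proof.
move=> cF; elim: r => [|i r IH].
  rewrite (_ : (fun y => _) = fun=> 0); first exact: contC.
  by apply/funext => y; rewrite big_nil.
rewrite (_ : (fun y => _) = fun y => F i y + \sum_(j <- r) F j y); first exact: contD.
by apply/funext => y; rewrite big_cons.
Qed.

Lemma continuous_slice (u : 'rV[R]_n -> R -> R) x t :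
  {for (x, t), continuous (fun q : 'rV[R]_n * R => u q.1 q.2)} ->
  {for x, continuous (u^~ t)}.
Proof.
apply: (@continuous_comp _ _ _ (fun y => (y, t))).
move=> B [[P Q] /= [Px Qt] PQ]; apply: (filterS _ Px) => y Py.
by apply: PQ; split => //=; exact: nbhs_singleton Qt.
Qed.

Lemma is_derive_inv f x v (d : R) : f x != 0 -> is_derive x v f d ->
  is_derive x v (fun y => (f y)^-1) (- (f x) ^- 2 *: d).
Proof. by move=> f0 [df <-]; split; [exact: derivableV|rewrite deriveV]. Qed.

End continuity.

(** * Energy identities against a test function *)

Section energy.
Variables (R : realType) (n : nat).
Implicit Types (A K : set 'rV[R]_n) (eta w g : 'rV[R]_n -> R).
Local Notation e_ i := (delta_mx ord0 i : 'rV[R]_n).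

(** What the energy arguments use of a test function. *)
Definition C1c K eta :=
  [/\ continuous eta, forall i x, is_derive x (e_ i) eta (pd i eta x),
      forall i, continuous (pd i eta) & supported K eta].

Lemma test_function_C1c A eta : test_function A eta ->
  exists K, [/\ compact K, K `<=` A & C1c K eta].
Proof.
move=> [Ce [K [cK KA eK]]]; exists K; split => //.
have [ce /= de] := Ce 1%N; split => //.
- by move=> x; exact: ce.
- by move=> i x; split; [apply: (de i).1|].
- by move=> i x; apply: (de i).2.1.
Qed.

Definition gradsq eta x := \sum_(i < n) pd i eta x ^+ 2.

Lemma C1c_pd_supported K eta i : compact K -> C1c K eta -> supported K (pd i eta).
Proof. by move=> cK [_ _ _ sK]; exact: supported_pd. Qed.

Lemma Cc_gradsq K eta : compact K -> C1c K eta -> Cc (gradsq eta).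
Proof.
move=> cK ce; apply: Cc_sum => i; have [_ _ ci _] := ce.
apply: (supported_Cc (A := setT) (K := K)) => //.
  by move=> x nKx; rewrite (C1c_pd_supported i cK ce nKx) expr0n.
by move=> x _; exact/contX2/ci.
Qed.

Lemma Cc_sqr A K eta g : compact K -> K `<=` A -> C1c K eta ->
  (forall x, A x -> {for x, continuous g}) -> Cc (fun x => eta x ^+ 2 * g x).
Proof.
move=> cK KA [ce _ _ sK] cg; apply: (supported_Cc cK KA).
  by move=> x nKx; rewrite sK// expr0n mul0r.
by move=> x Ax; exact: (contM (contX2 (ce x)) (cg x Ax)).
Qed.

Lemma Cc_sqr1 K eta : compact K -> C1c K eta -> Cc (fun x => eta x ^+ 2).
Proof.
move=> cK ce; under eq_fun do rewrite -[_ ^+ 2]mulr1.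
by apply: (@Cc_sqr setT K) => // x _; exact: contC.
Qed.

(** Divergence theorem for the field [eta grad w]. *)
Lemma weak_eigen A K eta w (lam : R) : compact K -> K `<=` A -> C1c K eta ->
  Ck 2 A w -> (forall x, A x -> - laplacian w x = lam * w x) ->
  Cc (fun x => \sum_(i < n) pd i eta x * pd i w x - lam * (eta x * w x)) /\
  Int (fun x => \sum_(i < n) pd i eta x * pd i w x - lam * (eta x * w x)) = 0.
Proof.
move=> cK KA ce /Ck2P[cw dw cdw ddw cddw] lw.
have [ce0 de cde sK] := ce; have spd i := C1c_pd_supported i cK ce.
pose F i x := eta x * pd i w x.
pose G i x := pd i eta x * pd i w x + eta x * pd i (pd i w) x.
have GE : (fun x => \sum_(i < n) pd i eta x * pd i w x - lam * (eta x * w x)) =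
          (fun x => \sum_(i < n) G i x).
  apply/funext => x; rewrite /G big_split/=; congr (_ + _); rewrite -mulr_sumr.
  have [Kx|nKx] := pselect (K x); last by rewrite sK// !mul0r mulr0 oppr0.
  by have := lw x (KA _ Kx); rewrite /laplacian => h; rewrite mulrCA -h mulrN opprK.
have sG i : supported K (G i) by move=> x nKx; rewrite /G spd// sK// !mul0r addr0.
have cG i x : A x -> {for x, continuous (G i)}.
  by move=> Ax; exact: (contD (contM (cde i x) (cdw i x Ax))
    (contM (ce0 x) (cddw i x Ax))).
rewrite GE; split.
  by apply: Cc_sum => i; exact: (supported_Cc cK KA (sG i) (cG i)).
apply: (Int_divergence (F := F) cK KA) => // i.
  by move=> x nKx; rewrite /F sK// mul0r.
move=> x Ax; have d1 := de i x; have d2 := ddw i x Ax.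
apply: (is_derive_eq (is_deriveM d1 d2)).
by rewrite /G /GRing.scale/= addrC (mulrC (pd i eta x)).
Qed.

(** Picone's inequality.  The divergence of [eta^2 grad g / g] integrates to zero,
    and it is at most [|grad eta|^2 + eta^2 Lap g / g], the difference being
    [|grad eta - eta grad g / g|^2]. *)
Lemma picone A K eta g : compact K -> K `<=` A -> C1c K eta ->
  Ck 2 A g -> (forall x, A x -> 0 < g x) ->
  0 <= Int (gradsq eta) + Int (fun x => eta x ^+ 2 * (laplacian g x / g x)).
Proof.
move=> cK KA ce /Ck2P[cg dg cdg ddg cddg] g0.
have [ce0 de cde sK] := ce; have spd i := C1c_pd_supported i cK ce.
have cgV x : A x -> {for x, continuous (fun y => (g y)^-1)}.
  move=> Ax; have gx0 : g x != 0 by rewrite gt_eqF ?g0.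
  exact: (contV gx0 (cg x Ax)).
pose F i x := eta x ^+ 2 * (pd i g x / g x).
pose G i x := 2 * eta x * pd i eta x * (pd i g x / g x) +
  eta x ^+ 2 * (pd i (pd i g) x / g x - (pd i g x / g x) ^+ 2).
have sG i : supported K (G i) by move=> x nKx; rewrite /G sK// expr0n mulr0 !mul0r addr0.
have cG i x : A x -> {for x, continuous (G i)}.
  move=> Ax; have h1 := contM (cdg i x Ax) (cgV x Ax).
  have h2 := contM (cddg i x Ax) (cgV x Ax).
  have h3 : {for x, continuous (fun x => eta x ^+ 2)} := contX2 (ce0 x).
  have h4 : {for x, continuous (fun x => 2 * eta x)} := contM (@contC _ _ 2 x) (ce0 x).
  have h5 : {for x, continuous (fun x => (pd i g x / g x) ^+ 2)} := contX2 h1.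
  exact: (contD (contM (contM h4 (cde i x)) h1) (contM h3 (contB h2 h5))).
have clap : Cc (fun x => eta x ^+ 2 * (laplacian g x / g x)).
  apply: (Cc_sqr cK KA ce) => x Ax; apply: (contM _ (cgV x Ax)).
  by apply: cont_sum => i; exact: cddg.
rewrite -IntD//; last exact: (Cc_gradsq cK ce).
have <- : Int (fun x => \sum_(i < n) G i x) = 0.
  apply: (Int_divergence (F := F) cK KA) => // i.
    by move=> x nKx; rewrite /F sK// expr0n mul0r.
  move=> x Ax; have d1 := de i x; have d2 := ddg i x Ax; have d3 := dg i x Ax.
  have gx0 : g x != 0 by rewrite gt_eqF ?g0.
  apply: (is_derive_eq (is_deriveM (is_deriveX 2 d1)
    (is_deriveM d2 (is_derive_inv gx0 d3)))).
  rewrite /G /GRing.scale/= exprfctE mulrfctE/= expr1; field.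
  exact: gx0.
apply: le_Int => [||x].
- by apply: Cc_sum => i; exact: (supported_Cc cK KA (sG i) (cG i)).
- by apply: CcD => //; exact: (Cc_gradsq cK ce).
rewrite /gradsq /laplacian mulr_suml mulr_sumr -big_split/=; apply: ler_sum => i _.
rewrite -subr_ge0
  (_ : _ - _ = (pd i eta x - eta x * (pd i g x / g x)) ^+ 2) ?sqr_ge0//.
rewrite /G; ring.
Qed.

End energy.

(** * Averages over a period *)

Section time_average.
Variables (R : realType).

(** Uniform continuity in time, uniformly in space on [K]: by compactness of
    [K x [0, T]], radii of continuity can be chosen independent of the point. *)
Lemma time_unif_continuous n (K : set 'rV[R]_n) (T : R)
    (p : 'rV[R]_n -> R -> R) (e : R) :
  compact K -> 0 < e ->
  (forall x t, K x ->
     {for (x, t), continuous (fun q : 'rV[R]_n * R => p q.1 q.2)}) ->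
  exists2 d : R, 0 < d & forall x s t, K x -> 0 <= s <= T -> `|s - t| < d ->
    `|p x s - p x t| < e.
Proof.
move=> cK e0 cp.
have cKT : compact (K `*` `[0, T]%classic).
  by apply: compact_setX => //; exact: segment_compact.
have := (compact_near_coveringP _).1 cKT R (0 : R)^'+
  (fun d q => forall t, `|q.2 - t| < d -> `|p q.1 q.2 - p q.1 t| < e) _.
have cov' : forall q : 'rV[R]_n * R, (K `*` `[0, T]%classic) q ->
   \forall q' \near q & d \near (0 : R)^'+,
    (forall t, `|q'.2 - t| < d -> `|p q'.1 q'.2 - p q'.1 t| < e).
  move=> [x s] [/= Kx _].
  have e2 : 0 < e / 2 by rewrite divr_gt0.
  have /cvgrPdist_lt/(_ _ e2)/nbhs_ballP[r /= r0 rP] := cp x s Kx.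
  have r2 : 0 < r / 2 by rewrite divr_gt0.
  exists (ball (x, s) (r / 2), [set d | d < r / 2]).
    split => /=; first exact: nbhsx_ballx.
    by apply: nbhs_right_lt.
  move=> [[x' s'] d] [/= [xx' ss'] dr] t st.
  have rr : r / 2 <= r by rewrite ler_pdivrMr// ler_peMr ?ltW// ltr1n.
  have h1 : `|p x s - p x' s'| < e / 2.
    by apply: (rP (x', s')); split; [exact: le_ball xx'|exact: le_ball ss'].
  have h2 : `|p x s - p x' t| < e / 2.
    apply: (rP (x', t)); split; first exact: le_ball xx'.
    rewrite /ball/= (le_lt_trans (ler_distD s' _ _))// (splitr r) ltrD//.
    exact: (lt_trans st).
  by rewrite (le_lt_trans (ler_distD (p x s) _ _))// (splitr e) ltrD// distrC.
move=> /(_ (at_right_proper_filter 0) cov') H.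
have [d [d0 dP]] := filter_ex (filterI (nbhs_right_gt 0) H).
by exists d => // x s t Kx sT; apply: (dP (x, s)); split => //=; rewrite in_itv.
Qed.

(** [p] is the derivative of [ln u], whose increments over the [m.+1] steps add up
    to zero by periodicity.  Each increment is the step times a value of [p] at an
    intermediate time, so those values sum to zero exactly, and the sample values
    differ from them by less than [e]. *)
Lemma riemann_log_derivative (u p : R -> R) (T e d : R) (m : nat) :
  0 < T -> (forall t, 0 < u t) ->
  (forall t : R, is_derive t (1 : R) u (u t * p t)) ->
  u T = u 0 ->
  (forall s t, 0 <= s <= T -> `|s - t| < d -> `|p s - p t| < e) ->
  T / m.+1%:R < d ->
  `|\sum_(k < m.+1) p (k%:R * (T / m.+1%:R))| <= m.+1%:R * e.
Proof.
move=> T0 u0 du uT pd Td; pose h := T / m.+1%:R.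
have h0 : 0 < h by rewrite divr_gt0.
have dL (t : R) : is_derive t (1 : R) (@ln R \o u) (p t).
  have := is_derive1_ln (u0 t) => d1.
  apply: (is_derive_eq (is_derive1_comp d1 (du t))).
  by rewrite mulKf// gt_eqF.
have cL : continuous (@ln R \o u).
  move=> t; apply: differentiable_continuous; apply/derivable1_diffP.
  exact: (@ex_derive _ _ _ _ _ _ _ (dL t)).
have /choice[c cP] : forall k : nat, exists c, `|k%:R * h - c| < d /\
    ln (u (k.+1%:R * h)) - ln (u (k%:R * h)) = p c * h.
  move=> k; have kk : k%:R * h < k.+1%:R * h by rewrite ltr_pM2r// ltr_nat.
  have [c + cE] := MVT kk (fun t _ => dL t) (continuous_subspaceT cL).
  rewrite in_itv/= => /andP[kc ck]; exists c; split.
    rewrite distrC ger0_norm ?subr_ge0 ?(ltW kc)// (le_lt_trans _ Td)//.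
    by rewrite lerBlDr (le_trans (ltW ck))// -/h -natr1 mulrDl mul1r addrC.
  by rewrite cE -mulrBl -natrB// subSnn mul1r.
have : \sum_(0 <= k < m.+1) (ln (u (k.+1%:R * h)) - ln (u (k%:R * h))) = 0.
  rewrite (telescope_sumr (fun k => ln (u (k%:R * h))))// mul0r -uT /h.
  by rewrite mulrCA divff// mulr1 subrr.
rewrite big_mkord; under eq_bigr do rewrite (cP _).2.
rewrite -mulr_suml => /eqP; rewrite mulf_eq0 (gt_eqF h0) orbF => /eqP s0.
have -> : \sum_(k < m.+1) p (k%:R * h) = \sum_(k < m.+1) (p (k%:R * h) - p (c k)).
  by rewrite sumrB s0 subr0.
apply: (le_trans (ler_norm_sum _ _ _)).
rewrite mulr_natl -[m.+1 in leRHS]card_ord -sumr_const; apply: ler_sum => k _.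
have kT : 0 <= k%:R * h <= T.
  rewrite mulr_ge0 ?(ltW h0)//= /h mulrCA ger_pMr// ler_pdivrMr// mul1r ler_nat.
  exact: ltnW.
exact: ltW (pd _ _ kT (cP k).1).
Qed.

End time_average.

Section periodic.
Variables (R : realType) (n : nat).
Implicit Types (A K : set 'rV[R]_n).

Lemma Int_sqr_ge0 K (eta : 'rV[R]_n -> R) : compact K -> C1c K eta ->
  0 <= Int (fun x => eta x ^+ 2).
Proof.
move=> cK ce; have <- : Int (fun _ : 'rV[R]_n => 0) = 0 :> R.
  by rewrite /Int Rintegral_cst// mul0r.
by apply: le_Int => [||x]; [exact: Cc0|exact: (Cc_sqr1 cK)|exact: sqr_ge0].
Qed.

(** The energy inequality of the moving problem on a fixed set [A].  [picone] at
    time [t], multiplied by [D], bounds [Q] below by minus the integral of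
    [eta^2 d/dt (ln psi)]; summing over sample times bounds it below by any
    negative multiple of [S]. *)
Lemma periodic_energy A K (D T mu : R)
    (psi : 'rV[R]_n -> R -> R) (eta : 'rV[R]_n -> R) :
  0 < D -> 0 < T -> compact K -> K `<=` A -> C1c K eta ->
  (forall t, Ck 2 A (psi^~ t)) ->
  (forall x t, A x -> 0 < psi x t) ->
  (forall x t, A x -> derivable (psi x) t 1) ->
  (forall x t, A x ->
     {for (x, t), continuous (fun q : 'rV[R]_n * R => psi q.1 q.2)}) ->
  (forall x t, A x ->
     {for (x, t), continuous (fun q : 'rV[R]_n * R => pdt psi q.1 q.2)}) ->
  (forall x t, A x -> pdt psi x t = D * laplacian (psi^~ t) x + mu * psi x t) ->
  (forall x, A x -> psi x T = psi x 0) ->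
  mu * Int (fun x => eta x ^+ 2) <= D * Int (gradsq eta).
Proof.
move=> D0 T0 cK KA ce Cpsi psi0 dpsi cpsi cdpsi eqpsi Tpsi.
have [ce0 _ _ sK] := ce.
pose p x t := pdt psi x t / psi x t.
set S := Int (fun x => eta x ^+ 2); set Q := D * Int (gradsq eta) - mu * S.
have S0 : 0 <= S := Int_sqr_ge0 cK ce.
have cp x t : A x -> {for (x, t), continuous (fun q : 'rV[R]_n * R => p q.1 q.2)}.
  move=> Ax; apply: cvgM; first exact: cdpsi.
  by apply: cvgV; [rewrite gt_eqF ?psi0|exact: cpsi].
have cpx t x (Ax : A x) : {for x, continuous (p^~ t)}.
  exact: continuous_slice (cp x t Ax).
have CCp t : Cc (fun x => eta x ^+ 2 * p x t).
  by exact: (Cc_sqr cK KA ce (cpx t)).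
have CCs : Cc (fun x => eta x ^+ 2) by exact: (Cc_sqr1 cK).
have Qp t : - Int (fun x => eta x ^+ 2 * p x t) <= Q.
  have := picone cK KA ce (Cpsi t) (fun x => @psi0 x t).
  have -> : (fun x => eta x ^+ 2 * (laplacian (psi^~ t) x / psi x t)) =
            (fun x => D^-1 * (eta x ^+ 2 * p x t + (- mu) * eta x ^+ 2)).
    apply/funext => x; have [Kx|nKx] := pselect (K x); last first.
      by rewrite sK// expr0n !(mul0r, mulr0, addr0).
    have Ax := KA _ Kx; have q0 : psi x t != 0 by rewrite gt_eqF ?psi0.
    rewrite /p eqpsi//; field.
    by rewrite q0 gt_eqF.
  rewrite IntZ; last exact: (CcD (CCp t) (CcZ (- mu) CCs)).
  rewrite (IntD (CCp t) (CcZ (- mu) CCs)).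
  rewrite IntZ// -/S -(pmulr_rge0 _ D0) mulrDr mulrA divff ?gt_eqF// mul1r => h.
  by rewrite /Q lerNl -subr_ge0; move: h; rewrite mulNr; lra.
have Qe e : 0 < e -> - (e * S) <= Q.
  move=> e0.
  have [d d0 dP] := time_unif_continuous T cK e0
    (fun x t Kx => cp x t (KA x Kx)).
  have dT : 0 < d / T by rewrite divr_gt0.
  have [m _ mP] := near_infty_natSinv_lt (PosNum dT).
  have Td : T / m.+1%:R < d by have := mP m (leqnn m); rewrite /= ltr_pdivlMr// mulrC.
  pose t_ k := k%:R * (T / m.+1%:R).
  have : - Int (fun x => \sum_(k < m.+1) eta x ^+ 2 * p x (t_ k)) <= m.+1%:R * Q.
    rewrite Int_sum// -sumrN mulr_natl -[m.+1 in leRHS]card_ord -sumr_const.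
    by apply: ler_sum => k _; exact: Qp.
  have : Int (fun x => \sum_(k < m.+1) eta x ^+ 2 * p x (t_ k)) <= m.+1%:R * (e * S).
    rewrite mulrA -IntZ//; apply: le_Int => [||x]; [exact: Cc_sum|exact: CcZ|].
    rewrite -mulr_sumr mulrC; have [Kx|nKx] := pselect (K x); last first.
      by rewrite sK// expr0n !mulr0.
    rewrite ler_wpM2r ?sqr_ge0// (le_trans (ler_norm _))//.
    have Ax := KA _ Kx.
    apply: (@riemann_log_derivative _ (psi x) (p x) T e d) => //.
    - by move=> t; exact: psi0.
    - move=> t; split; first exact: dpsi.
      by rewrite /p mulrC divfK ?gt_eqF ?psi0// /pdt derive1E.
    - exact: Tpsi.
    - by move=> s t; exact: dP.
  move=> h1 h2; have m0 : 0 < m.+1%:R :> R by rewrite ltr0n.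
  by rewrite -(ler_pM2l m0) mulrN (le_trans _ h2)// lerN2.
rewrite -subr_ge0 -/Q leNgt; apply/negP => Q0.
have e0 : 0 < - Q / (S + 1) by rewrite divr_gt0 ?oppr_gt0// ltr_wpDl.
have := Qe _ e0; rewrite leNgt => /negP; apply.
rewrite ltrNr mulrAC ltr_pdivrMr ?ltr_wpDl//.
by rewrite ltr_pM2l ?oppr_gt0// ltrDl.
Qed.

End periodic.

(** * Rayleigh quotient and the Dirichlet eigenvalue *)

Section rayleigh.
Variables (R : realType) (n : nat).
Implicit Types (A K : set 'rV[R]_n).

Lemma young_ineq (e a b : R) : 0 < e -> a * b <= e * a ^+ 2 + b ^+ 2 / (4 * e).
Proof.
move=> e0; rewrite -subr_ge0.
have -> : e * a ^+ 2 + b ^+ 2 / (4 * e) - a * b = (2 * e * a - b) ^+ 2 / (4 * e).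
  by field; rewrite gt_eqF.
by rewrite divr_ge0 ?sqr_ge0// mulr_ge0 ?ltW.
Qed.

(** Open sets have positive measure: this turns the positivity of an eigenfunction
    into a lower bound of the integral of its square. *)
Lemma open_box_lower_bound A x0 : open A -> A x0 -> forall (w : 'rV[R]_n -> R),
  {for x0, continuous w} -> 0 < w x0 ->
  exists (B : set 'rV[R]_n) (m : R), [/\ measurable B, B `<=` A, 0 < m,
    lebesgue_rV R n B = m%:E & forall x, B x -> w x0 / 2 < w x].
Proof.
move=> oA Ax0 w cw w0; have w2 : 0 < w x0 / 2 by rewrite divr_gt0.
have /cvgrPdist_lt/(_ _ w2) nw := cw.
have nA : nbhs x0 A by exact: open_nbhs_nbhs.
have [r /= r0 rP] := (nbhs_ballP _ _).1 (filterI nA nw).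
pose I i : set (measurableTypeR R) := `]x0 ord0 i - r, x0 ord0 i + r[%classic.
exists [set v | forall i, I i (v ord0 i)], ((r *+ 2) ^+ n).
have mI i : measurable (I i) by exact: measurable_itv.
have IB (x : 'rV[R]_n) : (forall i, I i (x ord0 i)) -> ball x0 r x.
  move=> Ix; split => // i j; rewrite ord1; have := Ix j.
  by rewrite /I/= in_itv/= /ball/= -ltr_distl distrC.
split.
- exact: (measurable_rV_cube (A := I)).
- by move=> x /IB/rP[].
- by rewrite exprn_gt0// pmulrn_lgt0.
- rewrite (lebesgue_rV_box (A := I))//.
  rewrite (eq_bigr (fun=> (r *+ 2)%:E)) => [|i _].
    by rewrite prodEFin prodr_const card_ord.
  rewrite /I lebesgue_measure_itv/= lte_fin ltrD2l gtrN// -EFinB; congr EFin.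
  by rewrite mulr2n; ring.
- move=> x /IB/rP[_ /=]; rewrite ltr_distlC => /andP[+ _].
  by rewrite {1}(splitr (w x0)) addrK.
Qed.

Lemma Rintegral_in A K f : K `<=` A -> supported K f -> measurable A ->
  \int[lebesgue_rV R n]_(x in A) f x = Int f.
Proof.
move=> KA fK mA; rewrite Rintegral_mkcond; apply: eq_Rintegral => x _.
by rewrite patchE; case: ifPn => //; rewrite notin_setE => nA; rewrite fK// => /KA.
Qed.

(** Suppose [lam < kappa], and put [rho = eta - w] for a test function [eta]
    close to [w].  Replacing [w] by [eta - rho] in the weak equation and absorbing
    the cross terms by Young's inequality with a small [e] gives
      [(1 - e) int |grad eta|^2 - (lam + e) int eta^2
         <= C int (rho^2 + |grad rho|^2)].
    By the bound with [kappa], the left side is at least [dl int eta^2], where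
    [dl > 0] once [e] is small.  So [int eta^2] tends to zero along the
    approximation, and [int w^2] with it, although [w] is bounded below by a
    positive constant on some box [B]. *)
Lemma dirichlet_rayleigh A (lam kappa : R) : open A -> A !=set0 ->
  principal_dirichlet_eigenvalue A lam ->
  (forall eta, test_function A eta ->
     kappa * Int (fun x => eta x ^+ 2) <= Int (gradsq eta)) ->
  kappa <= lam.
Proof.
move=> oA [x0 Ax0] [w [Cw eqw [eta teta cveta] w0]] ray.
rewrite leNgt; apply/negP => lk.
have mA : measurable A by exact: open_measurable_rV.
have [cw dw cdw _ _] := Ck2P Cw.
have [B [m [mB BA m0 mBE wB]]] := open_box_lower_bound oA Ax0 (cw _ Ax0) (w0 _ Ax0).
pose c := w x0 / 2; have c0 : 0 < c by rewrite divr_gt0 ?w0.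
(* [k1] dominates [kappa + 1], so that [e * (kappa + 1) < kappa - lam]; the bound
   1/2 keeps the coefficient of the gradient term positive. *)
pose k1 := `|kappa| + 2; have k10 : 0 < k1 by rewrite ltr_wpDl.
pose e := Num.min (1 / 2) ((kappa - lam) / k1).
have e0 : 0 < e by rewrite lt_min divr_gt0//= divr_gt0// subr_gt0.
have e1 : e <= 1 / 2 by rewrite ge_min lexx.
pose dl := (1 - e) * kappa - (lam + e).
have dl0 : 0 < dl.
  have h1 : e * k1 <= kappa - lam by rewrite -ler_pdivlMr// ge_min lexx orbT.
  have h2 : e * kappa <= e * `|kappa| by rewrite ler_wpM2l ?ler_norm ?ltW.
  by move: h1 h2; rewrite /dl /k1 mulrDr mulrBl mul1r; lra.
pose C := (1 + lam ^+ 2) / (4 * e).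
have C0 : 0 < C by rewrite /C divr_gt0 ?mulr_gt0 ?ltr_wpDr ?sqr_ge0.
pose r k x := (eta k x - w x) ^+ 2 +
  \sum_(i < n) (pd i (eta k) x - pd i w x) ^+ 2.
(* The squared H^1 distance below which the last inequality contradicts
   [0 < m]. *)
pose th := dl * c ^+ 2 * m / (2 * dl + 2 * C).
have dC0 : 0 < 2 * dl + 2 * C by rewrite addr_gt0// mulr_gt0.
have dc0 : 0 < dl * c ^+ 2 by rewrite mulr_gt0// exprn_gt0.
have th0 : 0 < th by apply: divr_gt0 => //; exact: mulr_gt0.
have [/= fink /cvgr0_norm_lt/(_ _ th0) rk] := (fine_cvgP _ _).1 cveta.
have [k [/= finr rth]] := filter_ex (filterI fink rk).
have [K [cK KA ce]] := test_function_C1c (teta k).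
have [ce0 de cde sK] := ce.
have r_ge0 x : 0 <= r k x.
  by rewrite addr_ge0 ?sqr_ge0// sumr_ge0// => i _; exact: sqr_ge0.
have cr x : A x -> {for x, continuous (r k)}.
  move=> Ax; apply: contD; first exact/contX2/(contB (ce0 x) (cw x Ax)).
  by apply: cont_sum => i; exact/contX2/(contB (cde i x) (cdw i x Ax)).
have ir : (lebesgue_rV R n).-integrable A (EFin \o r k).
  apply/integrableP; split.
    by apply/measurable_EFinP; apply: (open_measurable_fun_rV oA cr).
  under eq_integral do rewrite /= ger0_norm//.
  by rewrite -ge0_fin_numE// integral_ge0// => x _; rewrite lee_fin.
have [CW IW] := weak_eigen cK KA ce Cw eqw.
set W := (fun x => _ - _) in CW IW.
pose l x := (1 - e) * gradsq (eta k) x + (- (lam + e)) * eta k x ^+ 2 + (-1) * W x.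
have CS := Cc_sqr1 cK ce; have CG := Cc_gradsq cK ce.
have Cl : Cc l by exact: CcD (CcD (CcZ _ CG) (CcZ _ CS)) (CcZ _ CW).
have IlE : Int l =
    (1 - e) * Int (gradsq (eta k)) - (lam + e) * Int (fun x => eta k x ^+ 2).
  rewrite /l IntD; [|exact: CcD (CcZ _ CG) (CcZ _ CS)|exact: CcZ].
  rewrite IntD; [|exact: CcZ|exact: CcZ].
  by rewrite !IntZ// IW mulr0 addr0 mulNr.
have Il : dl * Int (fun x => eta k x ^+ 2) <= Int l.
  rewrite IlE /dl mulrBl lerD2r -mulrA ler_wpM2l ?ray//.
  by rewrite subr_ge0 (le_trans e1)// ler_pdivrMr// mul1r ler1n.
have lle x : A x -> l x <= C * r k x.
  move=> _; rewrite /l /W /r /C /gradsq.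
  have -> : (1 + lam ^+ 2) / (4 * e) = 1 / (4 * e) + lam ^+ 2 / (4 * e).
    by rewrite -mulrDl.
  set E2 := (eta k x - w x) ^+ 2; set GE := \sum_(i < n) (_ - _) ^+ 2.
  have E20 : 0 <= E2 by exact: sqr_ge0.
  have GE0 : 0 <= GE by apply: sumr_ge0 => i _; exact: sqr_ge0.
  have e40 : 0 <= 4 * e by rewrite mulr_ge0 ?ltW.
  have e4 : 0 <= 1 / (4 * e) by rewrite divr_ge0.
  have l4 : 0 <= lam ^+ 2 / (4 * e) by rewrite divr_ge0 ?sqr_ge0.
  have y1 : (1 - e) * gradsq (eta k) x -
      \sum_(i < n) pd i (eta k) x * pd i w x <= 1 / (4 * e) * GE.
    rewrite /gradsq /GE !mulr_sumr -sumrB; apply: ler_sum => i _.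
    have := young_ineq (pd i (eta k) x) (pd i (eta k) x - pd i w x) e0.
    rewrite mul1r (mulrC _^-1); set a := pd i (eta k) x; set b := pd i w x.
    lra.
  have y2 : - (lam + e) * eta k x ^+ 2 + lam * (eta k x * w x) <=
      lam ^+ 2 / (4 * e) * E2.
    have := young_ineq (eta k x) (- lam * (eta k x - w x)) e0.
    rewrite exprMn sqrrN -/E2 mulrAC; lra.
  have y3 := mulr_ge0 e4 E20; have y4 := mulr_ge0 l4 GE0.
  rewrite /gradsq in y1; lra.
pose f x := 2 * l x + (- (2 * dl)) * eta k x ^+ 2.
have Cf : Cc f by exact: CcD (CcZ _ Cl) (CcZ _ CS).
have sf : supported K f.
  move=> x nKx; rewrite /f /l /W /gradsq sK// expr0n !big1 => [|i _|i _].
  - by rewrite !(mulr0, mul0r, subr0, addr0).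
  - by rewrite (C1c_pd_supported i cK ce nKx) mul0r.
  - by rewrite (C1c_pd_supported i cK ce nKx) expr0n.
have If : 0 <= Int f.
  rewrite /f IntD; [|exact: CcZ|exact: CcZ].
  by rewrite !IntZ// mulNr subr_ge0 -mulrA ler_pM2l.
pose g x := dl * c ^+ 2 * \1_B x.
have IB : (\int[lebesgue_rV R n]_(x in A) (\1_B x)%:E = m%:E)%E.
  rewrite integral_indic//; move: mBE; rewrite (_ : B `&` A = B)//; exact/setIidPl.
have iB : (lebesgue_rV R n).-integrable A (EFin \o \1_B).
  apply/integrableP; split; first exact/measurable_EFinP/measurable_indic.
  under eq_integral do rewrite /= ger0_norm//.
  by rewrite IB ltry.
have ig : (lebesgue_rV R n).-integrable A (EFin \o g).
  exact: (integrableZl mA (dl * c ^+ 2) iB).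
have ifA : (lebesgue_rV R n).-integrable A (EFin \o f).
  by apply: integrableS (Cc_integrable Cf).
(* [w^2 <= 2 eta^2 + 2 (eta - w)^2] on [B] and the bound on [l] are added before
   integrating: [f] is the combination of [l] and [eta^2] with nonnegative
   integral, which leaves only the measure of [B] on the left. *)
have : \int[lebesgue_rV R n]_(x in A) (g x + f x) <=
       \int[lebesgue_rV R n]_(x in A) ((2 * dl + 2 * C) * r k x).
  apply: le_Rintegral => //.
  - exact: (integrableD mA ig ifA).
  - exact: (integrableZl mA (2 * dl + 2 * C) ir).
  - move=> x Ax; have h1 := lle x Ax.
    have h2 : c ^+ 2 * \1_B x <= 2 * (eta k x ^+ 2 + r k x).
      rewrite indicE; case: (boolP (x \in B)) => [|_]; last first.
        by rewrite mulr0 mulr_ge0// addr_ge0 ?sqr_ge0.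
      rewrite inE => /wB cwx; rewrite mulr1 (@le_trans _ _ (w x ^+ 2))//.
        by rewrite ler_sqr ?nnegrE ?ltW// w0.
      have : (eta k x - w x) ^+ 2 <= r k x.
        by rewrite lerDl; apply: sumr_ge0 => i _; exact: sqr_ge0.
      have := sqr_ge0 (2 * eta k x - w x); nra.
    have h3 : dl * (c ^+ 2 * \1_B x) <= dl * (2 * (eta k x ^+ 2 + r k x)).
      by rewrite ler_pM2l.
    rewrite /g /f; move: h1 h3; lra.
rewrite RintegralD// (Rintegral_in KA sf mA).
have -> : \int[lebesgue_rV R n]_(x in A) g x = dl * c ^+ 2 * m.
  by rewrite /g RintegralZl// /Rintegral IB.
rewrite RintegralZl//.
have rE : \int[lebesgue_rV R n]_(x in A) r k x < th.
  by rewrite (le_lt_trans (ler_norm _)).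
rewrite leNgt => /negP; apply.
rewrite (@lt_le_trans _ _ (dl * c ^+ 2 * m))// ?lerDl//.
by rewrite mulrC -ltr_pdivlMr.
Qed.

End rayleigh.

(** * The periodic eigenvalue *)

Lemma C21_Ck2 (R : realType) (n : nat) (Q : set ('rV[R]_n * R)) u A t :
  C21 Q u -> (forall x, A x -> Q (x, t)) -> Ck 2 A (u^~ t).
Proof.
move=> [cu _ du ddu] AQ; split.
  by move=> x /AQ Qx; exact: (continuous_slice (cu _ Qx)).
move=> i; split; first by move=> x /AQ; exact: (du i).1.
split; first by move=> x /AQ/(du i).2; exact: (@continuous_slice _ _ (fun x t => pd i (u^~ t) x)).
move=> j; split; first by move=> x /AQ; exact: (ddu j i).1.
split => // x /AQ/(ddu j i).2.
exact: (@continuous_slice _ _ (fun x t => pd j (pd i (u^~ t)) x)).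
Qed.

Theorem theorem2 (R : realType) (N : nat) (D T : R)
    (Omega : R -> set 'rV[R]_N) (Omega0 : set 'rV[R]_N)
    (h : 'rV[R]_N -> R -> 'rV[R]_N)
    (a : 'I_N -> 'I_N -> 'rV[R]_N -> R -> R)
    (b c : 'I_N -> 'rV[R]_N -> R -> R)
    (mu lambda1 : R) (Omega1 : set 'rV[R]_N)
    (N_gt0 : (0 < N)%N) (D_gt0 : 0 < D) (T_gt0 : 0 < T)
    (Omega_periodic : periodic_domain D T Omega Omega0 h a b c)
    (mu_principal : principal_periodic_eigenvalue T Omega0 a b c mu)
    (Omega1_domain : domain Omega1)
    (Omega1_sub : forall t, Omega1 `<=` Omega t)
    (lambda1_principal : principal_dirichlet_eigenvalue Omega1 lambda1) :
  mu <= D * lambda1.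

Proof.
have [phi [phi_dir phi_eq phi_gt0 phi_T]] := mu_principal.
pose psi (x : 'rV[R]_N) (t : R) := phi (h x t) t.
have phi_solves : solves_fixed a b c (fun v => mu * v) Omega0 phi.
  by split => // t xi xiO; rewrite -phi_eq// addrC subrK.
have [[Cpsi _ _] psi_eq] := (@pd_transforms _ _ _ _ _ _ _ _ _ _
  Omega_periodic (fun v => mu * v) psi phi (fun t x _ => erefl)).2 phi_solves.
have psi_gt0 x t : Omega1 x -> 0 < psi x t.
  move=> /(Omega1_sub t) Ox; apply: phi_gt0.
  by rewrite -(pd_h_image Omega_periodic t); exists x.
have psi_T x : Omega1 x -> psi x T = psi x 0.
  move=> /(Omega1_sub 0) Ox; have cx := subset_closure Ox.
  rewrite /psi -{1}[T]add0r (pd_h_periodic Omega_periodic)//.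
  rewrite -[in LHS](add0r T) -phi_T// -(pd_h_image Omega_periodic 0).
  exact/subset_closure/imageP.
have O1 x t : Omega1 x -> spacetime Omega (x, t) by exact: Omega1_sub.
have [oO1 _ O10] := Omega1_domain.
rewrite mulrC -ler_pdivrMr//; apply: (dirichlet_rayleigh oO1 O10 lambda1_principal).
move=> eta /test_function_C1c[K [cK KO1 ce]].
rewrite mulrAC ler_pdivrMr// [leRHS]mulrC.
apply: (periodic_energy (T := T) (psi := psi) D_gt0 T_gt0 cK KO1 ce) => //.
- by move=> t; apply: (C21_Ck2 Cpsi) => x; exact: O1.
- by case: Cpsi => _ [dt _] _ _ x t Ox; exact/dt/O1.
- by case: Cpsi => cpsi _ _ _ x t Ox; exact/cpsi/O1.
- by case: Cpsi => _ [_ cdt] _ _ x t Ox; exact/cdt/O1.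
- by move=> x t Ox; exact/psi_eq/Omega1_sub.
Qed.
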